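(* Let $X=(x_1,\ldots,x_n)^T\in\mathbb R^{n\times p}$, $Y=(y_1,\ldots,y_n)^T\in\mathbb R^{n\times m}$, and let $r$ be a rank bound. (i) Suppose $\Theta(\cdot;\lambda)$ is an arbitrary threshold function, and let $P$ be any penalty associated with $\Theta$ through $$P(t;\lambda)-P(0;\lambda)=P_\Theta(t;\lambda)+q(t;\lambda),\qquad P_\Theta(t;\lambda)=\int_0^{|t|}\big[\sup\{s:\Theta(s;\lambda)\le u\}-u\big]\,du,$$ for some nonnegative $q(\cdot;\lambda)$ with $q\{\Theta(s;\lambda);\lambda\}=0$ for all $s\in\mathbb R$. Consider $$\min_{B\in\mathbb R^{p\times m},\,C\in\mathbb R^{n\times m}}\ \tfrac12\|Y-XB-C\|_F^2+\sum_{i=1}^nP(\|c_i\|_2;\lambda)\quad\text{subject to }\mathrm{rank}(B)\le r,\qquad(\ast)$$ where $c_i^T$ is the $i$th row of $C$. For any fixed $B$, a globally optimal solution for $C$ is $C(B)=\vec\Theta(Y-XB;\lambda)$. By profiling out $C$ with $C(B)$, $(\ast)$ can be expressed as an optimization problem with respect to $B$ only, and it is equivalent (i.e. the profiled objective and the objective below coincide as functions of $B$ up to an additive constant not depending on $B$) to the robust M-estimation problem $$\min_B\ \sum_{i=1}^n\rho(\|y_i-B^Tx_i\|_2;\lambda)\quad\text{subject to }\mathrm{rank}(B)\le r,$$ where the robust loss function $\rho$ is given by $$\rho(t;\lambda)=\int_0^{|t|}\psi(u;\lambda)\,du,\qquad\psi(t;\lambda)=t-\Theta(t;\lambda).$$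 (ii) Given $\varrho\in\{0,1,\ldots,n\}$, consider $$\min_{B,C}\ \tfrac12\|Y-XB-C\|_F^2\quad\text{subject to }\mathrm{rank}(B)\le r,\ \|C\|_{2,0}\le\varrho .$$ Similarly, after profiling out $C$, this problem can be expressed as an optimization problem with respect to $B$ only, and is equivalent (in the same sense) to the rank-constrained trimmed least squares problem $$\min_B\ \tfrac12\sum_{i=1}^{n-\varrho}r_{(i)}^2\quad\text{subject to }\mathrm{rank}(B)\le r,\ \ r_i=\|y_i-B^Tx_i\|_2,$$ where $r_{(1)},\ldots,r_{(n)}$ are the order statistics of $r_1,\ldots,r_n$ satisfying $|r_{(1)}|\le\cdots\le|r_{(n)}|$.
   Context: Threshold function: a real-valued function $\Theta(t;\lambda)$ defined for $-\infty<t<\infty$ and $0\le\lambda<\infty$ such that (i) $\Theta(-t;\lambda)=-\Theta(t;\lambda)$; (ii) $\Theta(t;\lambda)\le\Theta(t';\lambda)$ for $t\le t'$; (iii) $\lim_{t\to\infty}\Theta(t;\lambda)=\infty$; (iv) $0\le\Theta(t;\lambda)\le t$ for $0\le t<\infty$. Multivariate threshold function: for $a\in\mathbb R^m$, $\vec\Theta(a;\lambda)=a\,\Theta(\|a\|_2;\lambda)/\|a\|_2$ if $a\ne0$ and $\vec\Theta(0;\lambda)=0$; for a matrix $A=(a_1\ \ldots\ a_n)^T\in\mathbb R^{n\times m}$, $\vec\Theta(A;\lambda)=\{\vec\Theta(a_1;\lambda)\ \ldots\ \vec\Theta(a_n;\lambda)\}^T$ (applied row by row). $\|\cdot\|_F$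 is the Frobenius norm and $\|C\|_{2,0}$ is the number of nonzero rows of $C$. *)

(* Defs.v *)
From HB Require Import structures.
From mathcomp Require Import all_boot all_order all_algebra.
From mathcomp Require Import all_classical all_reals all_analysis.
Import Order.TTheory GRing.Theory Num.Theory.
Import numFieldNormedType.Exports.

Set Implicit Arguments.
Unset Strict Implicit.
Unset Printing Implicit Defensive.

Local Open Scope classical_set_scope.
Local Open Scope ring_scope.

(* A matrix (a_1 ... a_n)^T has the vectors a_i as
   its rows; its i-th vector is used as a column vector. *)

Definition vec_of_row (R : Type) (n m : nat) (A : 'M[R]_(n, m)) (i : 'I_n)
  : 'cV[R]_m := (row i A)^T.

(* [`|A|] on matrices is the max norm in the library, hence the explicit
   definitions of the Euclidean and Frobenius norms. *)
Definition l2norm (R : realType) (m : nat) (a : 'cV[R]_m) : R :=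
  Num.sqrt (\sum_(j < m) a j 0 ^+ 2).

Definition frob_norm (R : realType) (n m : nat) (A : 'M[R]_(n, m)) : R :=
  Num.sqrt (\sum_(i < n) \sum_(j < m) A i j ^+ 2).

Definition norm20 (R : realType) (n m : nat) (C : 'M[R]_(n, m)) : nat :=
  #|[pred i : 'I_n | row i C != 0]|.

(* The parameter lambda ranges over [0, +oo[; the values of Theta at negative
   lambda are irrelevant. *)
Definition threshold_function (R : realType) (Theta : R -> R -> R) : Prop :=
  forall lambda : R, 0 <= lambda ->
  [/\ forall t : R, Theta (- t) lambda = - Theta t lambda,
      forall t t' : R, t <= t' -> Theta t lambda <= Theta t' lambda,
      Theta t lambda @[t --> +oo] --> +oo
    & forall t : R, 0 <= t -> 0 <= Theta t lambda <= t].

Definition vec_threshold (R : realType) (Theta : R -> R -> R) (lambda : R)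
    (m : nat) (a : 'cV[R]_m) : 'cV[R]_m :=
  if a == 0 then 0 else (Theta (l2norm a) lambda / l2norm a) *: a.

Definition mx_threshold (R : realType) (Theta : R -> R -> R) (lambda : R)
    (n m : nat) (A : 'M[R]_(n, m)) : 'M[R]_(n, m) :=
  \matrix_(i, j) vec_threshold Theta lambda (vec_of_row A i) j 0.

(* For u >= 0 the set under [sup] contains 0 and is bounded above, so [sup] is
   its actual least upper bound; u |-> sup {s | Theta s <= u} is nondecreasing
   there, so the Lebesgue integral is the ordinary Riemann one. *)
Definition P_Theta (R : realType) (Theta : R -> R -> R) (t lambda : R) : R :=
  \int[lebesgue_measure]_(u in `[0, `|t|])
    (sup [set s : R | Theta s lambda <= u] - u).

Definition associated_penalty (R : realType) (Theta P : R -> R -> R)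
    (lambda : R) : Prop :=
  exists q : R -> R,
    [/\ forall t : R, 0 <= q t,
        forall s : R, q (Theta s lambda) = 0
      & forall t : R, P t lambda - P 0 lambda = P_Theta Theta t lambda + q t].

Definition psi (R : realType) (Theta : R -> R -> R) (t lambda : R) : R :=
  t - Theta t lambda.

Definition rho (R : realType) (Theta : R -> R -> R) (t lambda : R) : R :=
  \int[lebesgue_measure]_(u in `[0, `|t|]) psi Theta u lambda.

Definition residual (R : realType) (n p m : nat) (X : 'M[R]_(n, p))
    (Y : 'M[R]_(n, m)) (B : 'M[R]_(p, m)) (i : 'I_n) : R :=
  l2norm (vec_of_row Y i - B^T *m vec_of_row X i).

Definition ls_objective (R : realType) (n p m : nat) (X : 'M[R]_(n, p))
    (Y : 'M[R]_(n, m)) (B : 'M[R]_(p, m)) (C : 'M[R]_(n, m)) : R :=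
  2^-1 * frob_norm (Y - X *m B - C) ^+ 2.

Definition penalized_objective (R : realType) (P : R -> R -> R) (lambda : R)
    (n p m : nat) (X : 'M[R]_(n, p)) (Y : 'M[R]_(n, m))
    (B : 'M[R]_(p, m)) (C : 'M[R]_(n, m)) : R :=
  ls_objective X Y B C + \sum_(i < n) P (l2norm (vec_of_row C i)) lambda.

Definition robust_objective (R : realType) (Theta : R -> R -> R) (lambda : R)
    (n p m : nat) (X : 'M[R]_(n, p)) (Y : 'M[R]_(n, m))
    (B : 'M[R]_(p, m)) : R :=
  \sum_(i < n) rho Theta (residual X Y B i) lambda.

Definition order_stats (R : realType) (n : nat) (r : 'I_n -> R) : seq R :=
  sort (fun a b : R => `|a| <= `|b|) [seq r i | i <- enum 'I_n].

(* [nth] counts from 0, so r_(1), ..., r_(n - k) have indices 0, ..., n - k - 1. *)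
Definition trimmed_objective (R : realType) (n p m : nat) (X : 'M[R]_(n, p))
    (Y : 'M[R]_(n, m)) (k : nat) (B : 'M[R]_(p, m)) : R :=
  2^-1 * \sum_(0 <= i < n - k) (nth 0 (order_stats (residual X Y B)) i) ^+ 2.

Definition minimizer (R : realType) (T : Type) (D : set T) (f : T -> R)
    (x : T) : Prop :=
  D x /\ forall y : T, D y -> f x <= f y.

Definition profiled (R : realType) (T U : Type) (E : set U) (f : T -> U -> R)
    (b : T) : R :=
  inf [set f b c | c in E].

(* The problem min f b c over b in D, c in E can be reduced, by profiling out
   c, to min g b over b in D: the inner minimum is attained for every b, the
   profiled objective is g up to an additive constant, and the solutions of
   the joint problem are the pairs made of a solution b of the reduced problem
   and an optimal c for that b. *)
Definition equivalent_by_profiling (R : realType) (T U : Type) (D : set T)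
    (E : set U) (f : T -> U -> R) (g : T -> R) : Prop :=
  [/\ forall b : T, exists c : U, minimizer E (f b) c,
      exists k : R, forall b : T, profiled E f b = g b + k
    & forall (b : T) (c : U),
        minimizer (D `*` E) (fun bc : T * U => f bc.1 bc.2) (b, c) <->
        minimizer D g b /\ minimizer E (f b) c].

(* Main.v *)
(** Both problems separate over the rows of C. By the reverse triangle
    inequality a row contributes at least (r - t)^2 / 2 + P(t), with r the
    residual and t the norm of the row, so in (i) all comes down to
    min_t [(r - t)^2 / 2 + P_Theta(t)] = rho(r). As
      P_Theta(t) = \int_0^t Theta^{-1} - t^2 / 2,
      rho(r) = r^2 / 2 - \int_0^r Theta,
    this is Young's inequality \int_0^r Theta + \int_0^t Theta^{-1} >= r t, with
    equality at t = Theta(r). Neither Theta nor its generalized inverse need be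
    continuous; the equality case is obtained by comparing secant slopes. In
    (ii) it is best to fit exactly the rows with the largest residuals. *)
Require Import Defs.
From HB Require Import structures.
From mathcomp Require Import all_boot all_order all_algebra.
From mathcomp Require Import all_classical all_reals all_analysis.
From mathcomp Require Import ring lra measurable_realfun.
Import Order.TTheory GRing.Theory Num.Theory.
Import numFieldNormedType.Exports.

Set Implicit Arguments.
Unset Strict Implicit.
Unset Printing Implicit Defensive.

Local Open Scope classical_set_scope.
Local Open Scope ring_scope.

(** * Integrals of nondecreasing functions *)

Lemma nondecreasing_integrable_itv (R : realType) (f : R -> R) (a b : R) :
  {homo f : x y / x <= y} ->
  (@lebesgue_measure R).-integrable `[a, b] (EFin \o f).
Proof.
move=> fnd; apply: measurable_bounded_integrable => //.
- by rewrite /= lebesgue_measure_itv/=; case: ifP => _; rewrite ?ltry.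
- exact: nondecreasing_measurable.
- exists (`|f a| + `|f b|); split => [|M HM x /=]; first exact: num_real.
  rewrite in_itv/= => /andP[ax xb]; apply: le_trans (ltW HM).
  have fax := fnd _ _ ax; have fxb := fnd _ _ xb.
  rewrite ler_norml; apply/andP.
  by case: (ger0P (f a)); case: (ger0P (f b)); split; lra.
Qed.

Lemma nondecreasing_integrable_oo (R : realType) (f : R -> R) (a b : R) :
  {homo f : x y / x <= y} ->
  (@lebesgue_measure R).-integrable `]a, b[ (EFin \o f).
Proof.
move=> fnd; apply: integrableS (nondecreasing_integrable_itv a b fnd) => //.
by apply: subset_itv; rewrite bnd_simp.
Qed.

(** Integrating over the open interval means that later bounds on the integrand are asked for
    strictly between the endpoints only: a generalized inverse may jump at an endpoint. *)
Lemma Rintegral_increment (R : realType) (f : R -> R) (a b : R) :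
  {homo f : x y / x <= y} -> 0 <= a -> a <= b ->
  \int[lebesgue_measure]_(u in `[0, b]) f u
    - \int[lebesgue_measure]_(u in `[0, a]) f u
  = \int[lebesgue_measure]_(u in `]a, b[) f u.
Proof.
move=> fnd a0 ab; rewrite Rintegral_itvB ?bnd_simp//; last first.
  exact: nondecreasing_integrable_itv.
by rewrite -Rintegral_itv_bndo_bndc//; exact: nondecreasing_integrable_oo.
Qed.

Lemma Rintegral_cst_oo (R : realType) (a b c : R) : a <= b ->
  \int[lebesgue_measure]_(u in `]a, b[) cst c u = c * (b - a).
Proof.
move=> ab; rewrite Rintegral_cst//= lebesgue_measure_itv/= lte_fin.
by case: ltgtP ab => //= ->; rewrite subrr.
Qed.

Lemma Rintegral_oo_le (R : realType) (f : R -> R) (a b c : R) :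
  {homo f : x y / x <= y} -> a <= b -> (forall u, a < u < b -> f u <= c) ->
  \int[lebesgue_measure]_(u in `]a, b[) f u <= c * (b - a).
Proof.
move=> fnd ab fc; rewrite -Rintegral_cst_oo//; apply: le_Rintegral => //.
all: exact: nondecreasing_integrable_oo.
Qed.

Lemma Rintegral_oo_ge (R : realType) (f : R -> R) (a b c : R) :
  {homo f : x y / x <= y} -> a <= b -> (forall u, a < u < b -> c <= f u) ->
  c * (b - a) <= \int[lebesgue_measure]_(u in `]a, b[) f u.
Proof.
move=> fnd ab fc; rewrite -Rintegral_cst_oo//; apply: le_Rintegral => //.
all: exact: nondecreasing_integrable_oo.
Qed.

(** * Secant slopes and areas under generalized inverses *)

(** On [[0, +oo[], [f] selects a subgradient of [F]: a substitute for the derivative [F' = f] that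
    survives jumps of [f]. *)
Definition secants_within (R : realType) (f F : R -> R) : Prop :=
  forall a b : R, 0 <= a -> a <= b ->
  f a * (b - a) <= F b - F a <= f b * (b - a).

Lemma secants_within_Rintegral (R : realType) (f : R -> R) :
  {homo f : x y / x <= y} ->
  secants_within f (fun x => \int[lebesgue_measure]_(u in `[0, x]) f u).
Proof.
move=> fnd a b a0 ab; rewrite Rintegral_increment//.
apply/andP; split; [apply: Rintegral_oo_ge|apply: Rintegral_oo_le] => // u.
  by move=> /andP[/ltW au _]; exact: fnd.
by move=> /andP[_ /ltW ub]; exact: fnd.
Qed.

(* On each piece of the subdivision of [0, x] into N + 1 equal parts the
   increments of F and G differ by at most x / (N + 1) times the increment
   of f, and the latter telescope. *)
Lemma secants_within_unique (R : realType) (f F G : R -> R) (x : R) :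
  {homo f : x y / x <= y} -> secants_within f F -> secants_within f G ->
  0 <= x -> F x - F 0 = G x - G 0.
Proof.
move=> fnd HF HG x0.
have bound N : `|(F x - F 0) - (G x - G 0)| * N.+1%:R <= x * (f x - f 0).
  set h := x / N.+1%:R.
  have h0 : 0 <= h by rewrite divr_ge0.
  have tele k : `|(F (k%:R * h) - F 0) - (G (k%:R * h) - G 0)|
      <= h * (f (k%:R * h) - f 0).
    elim: k => [|k IH]; first by rewrite mul0r !subrr normr0 mulr0.
    have kh0 : 0 <= k%:R * h by rewrite mulr_ge0.
    have khk : k%:R * h <= k.+1%:R * h by rewrite ler_wpM2r// ler_nat.
    have /andP[] := HF _ _ kh0 khk; have /andP[] := HG _ _ kh0 khk.
    have -> : k.+1%:R * h - k%:R * h = h by rewrite -natr1; ring.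
    move=> ? ? ? ?; move: IH.
    by rewrite !ler_norml => /andP[? ?]; apply/andP; split; lra.
  have xE : N.+1%:R * h = x by rewrite /h mulrC divfK ?pnatr_eq0.
  have := tele N.+1; rewrite xE => /(ler_wpM2r (ler0n R N.+1)).
  by rewrite mulrAC [h * _]mulrC xE.
apply/eqP; rewrite -subr_eq0 -normr_le0 leNgt; apply/negP => e0.
set e := `|_| in e0 bound; set A := x * _ in bound.
have Ae0 : 0 <= A / e.
  by rewrite divr_ge0 ?(ltW e0)// mulr_ge0// subr_ge0 fnd.
(* As [N] exceeds [A / e], the product of the gap [e] with [N + 1] exceeds [A], against
   [bound N]. *)
have := archi_boundP Ae0; set N := Num.bound _; rewrite ltr_pdivrMr// => AN.
have := bound N; rewrite -natr1; nra.
Qed.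

(* The derivative [g t - x] of the right-hand side changes sign at [t = f x]. *)
Lemma generalized_inverse_min (R : realType) (f g : R -> R) (x t : R) :
  {homo g : u v / u <= v} ->
  (forall u, 0 <= u -> u < f x -> g u <= x) ->
  (forall u, f x <= u -> x <= g u) ->
  0 <= f x -> 0 <= t ->
  \int[lebesgue_measure]_(u in `[0, f x]) g u - x * f x
  <= \int[lebesgue_measure]_(u in `[0, t]) g u - x * t.
Proof.
move=> gnd gx xg fx0 t0.
case: (leP t (f x)) => [tfx|/ltW fxt].
  have := Rintegral_increment gnd t0 tfx.
  have : \int[lebesgue_measure]_(u in `]t, f x[) g u <= x * (f x - t).
    apply: Rintegral_oo_le => // u /andP[tu]; apply: gx.
    by rewrite (le_trans t0)// ltW.
  lra.
have := Rintegral_increment gnd fx0 fxt.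
have : x * (t - f x) <= \int[lebesgue_measure]_(u in `]f x, t[) g u.
  by apply: Rintegral_oo_ge => // u /andP[/ltW fxu _]; exact: xg.
lra.
Qed.

Lemma Rintegral_itv00 (R : realType) (f : R -> R) :
  \int[lebesgue_measure]_(u in `[0, 0]) f u = 0.
Proof. by rewrite set_itv1 Rintegral_set1. Qed.

(* As functions of [x], both sides have their secant slope over any [[a, b]]
   between [f a] and [f b]; for the right-hand side this is
   [generalized_inverse_min] at [a] and at [b]. *)
Lemma generalized_inverse_area (R : realType) (f g : R -> R) (x : R) :
  {homo f : u v / u <= v} -> {homo g : u v / u <= v} -> f 0 = 0 ->
  (forall x u, 0 <= x -> 0 <= u -> u < f x -> g u <= x) ->
  (forall x u, 0 <= x -> f x <= u -> x <= g u) ->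
  0 <= x ->
  \int[lebesgue_measure]_(u in `[0, x]) f u
  = x * f x - \int[lebesgue_measure]_(u in `[0, f x]) g u.
Proof.
move=> fnd gnd f0 gf fg x0.
pose G y := \int[lebesgue_measure]_(u in `[0, y]) g u.
have f_ge0 y : 0 <= y -> 0 <= f y by move=> y0; rewrite -f0; exact: fnd.
have minG y z : 0 <= y -> 0 <= z -> G (f y) - y * f y <= G (f z) - y * f z.
  move=> y0 z0; apply: generalized_inverse_min; rewrite ?f_ge0//.
  - by move=> u; exact: gf.
  - by move=> u; exact: fg.
have HPhi : secants_within f (fun x => x * f x - G (f x)).
  move=> a b a0 ab; have b0 := le_trans a0 ab.
  have := minG _ _ a0 b0; have := minG _ _ b0 a0.
  by move: (G (f a)) (G (f b)) => Ga Gb ? ?; apply/andP; split; lra.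
have := secants_within_unique fnd (secants_within_Rintegral fnd) HPhi x0.
by rewrite /G f0 !Rintegral_itv00 mulr0 !subr0.
Qed.

(** The secant slope of [x ^+ 2 / 2] over [[a, b]] is [(a + b) / 2], which lies between [a] and [b],
    so uniqueness applies again. *)
Lemma Rintegral_id (R : realType) (x : R) : 0 <= x ->
  \int[lebesgue_measure]_(u in `[0, x]) u = 2^-1 * x ^+ 2.
Proof.
move=> x0; have idnd : {homo (@id R) : u v / u <= v} by [].
have Hsq : secants_within id (fun x : R => 2^-1 * x ^+ 2).
  by move=> a b a0 ab /=; apply/andP; split; nra.
have := secants_within_unique idnd (secants_within_Rintegral idnd) Hsq x0.
by rewrite !Rintegral_itv00 expr0n mulr0 !subr0.
Qed.

(** * The scalar problem *)

(** Once the square is expanded, the penalized value at [t] is [r ^+ 2 / 2 + (G t - r * t)], where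
    [G] integrates the generalized inverse [g] of [Theta]. It is least at [t = Theta r lambda], and
    the area formula identifies its value there with [rho]. *)
Lemma rho_le_penalized (R : realType) (Theta : R -> R -> R) (lambda r : R) :
  threshold_function Theta -> 0 <= lambda -> 0 <= r ->
  (forall t, 0 <= t ->
     rho Theta r lambda <= 2^-1 * (r - t) ^+ 2 + P_Theta Theta t lambda) /\
  rho Theta r lambda
  = 2^-1 * (r - Theta r lambda) ^+ 2 + P_Theta Theta (Theta r lambda) lambda.
Proof.
move=> HT l0 r0; have [Todd Tnd Tcvg Tle] := HT _ l0.
pose g u := sup [set s | Theta s lambda <= u].
pose G t := \int[lebesgue_measure]_(u in `[0, t]) g u.
have large M : exists s, M <= Theta s lambda.
  (* The limit at [+oo] gives the bound for arguments strictly above [s] only, hence the witness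
     [s + 1]. *)
  have [s [_ /(_ (s + 1))]] := (cvgryPge _).1 Tcvg M.
  by rewrite ltrDl ltr01 => /(_ isT); exists (s + 1).
have Tlt u x : u < Theta x lambda -> ubound [set s | Theta s lambda <= u] x.
  move=> ux s /= su; rewrite leNgt; apply/negP => /ltW /Tnd.
  by rewrite leNgt (le_lt_trans su ux).
(* Negative [u] are included so that [g] is nondecreasing on the whole line; there, oddness turns
   the limit at [+oo] into nonemptiness. *)
have hs u : has_sup [set s | Theta s lambda <= u].
  split; last first.
    have [s Hs] := large (u + 1); exists s; apply: Tlt.
    by rewrite (lt_le_trans _ Hs)// ltrDl.
  by have [s Hs] := large (- u); exists (- s) => /=; rewrite Todd lerNl.
have gnd : {homo g : u v / u <= v}.
  move=> u v uv; apply: ge_sup; first exact: (hs u).1.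
  by move=> s /= su; apply: sup_upper_bound => //=; exact: le_trans uv.
have gT x u : 0 <= x -> 0 <= u -> u < Theta x lambda -> g u <= x.
  by move=> _ _ ux; apply: ge_sup; [exact: (hs u).1|exact: Tlt].
have Tg x u : 0 <= x -> Theta x lambda <= u -> x <= g u.
  by move=> _ xu; exact: sup_upper_bound.
have T0 : Theta 0 lambda = 0.
  by apply/eqP; rewrite eq_sym eq_le; apply: Tle.
have PE t : 0 <= t -> P_Theta Theta t lambda = G t - 2^-1 * t ^+ 2.
  move=> t0; rewrite /P_Theta ger0_norm// RintegralB ?Rintegral_id//.
  - exact: nondecreasing_integrable_itv.
  - exact: nondecreasing_integrable_itv.
have rhoE : rho Theta r lambda = 2^-1 * r ^+ 2
    - \int[lebesgue_measure]_(u in `[0, r]) Theta u lambda.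
  rewrite /rho ger0_norm// RintegralB ?Rintegral_id//.
  - exact: nondecreasing_integrable_itv.
  - exact: nondecreasing_integrable_itv.
have /andP[Tr0 _] := Tle _ r0.
have area : \int[lebesgue_measure]_(u in `[0, r]) Theta u lambda
    = r * Theta r lambda - G (Theta r lambda).
  exact: (generalized_inverse_area (f := Theta ^~ lambda)).
split=> [t t0|]; rewrite rhoE PE// area; last by field.
have : G (Theta r lambda) - r * Theta r lambda <= G t - r * t.
  apply: (generalized_inverse_min (f := Theta ^~ lambda)) => // u.
    exact: gT.
  exact: Tg.
by move: (G _) (G t) => Gr Gt; nra.
Qed.

(** * Euclidean norms, thresholded vectors and row decomposition *)

Lemma sqr_l2norm (R : realType) (m : nat) (a : 'cV[R]_m) :
  l2norm a ^+ 2 = \sum_(j < m) a j 0 ^+ 2.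
Proof. by rewrite sqr_sqrtr// sumr_ge0// => j _; exact: sqr_ge0. Qed.

Lemma l2norm_ge0 (R : realType) (m : nat) (a : 'cV[R]_m) : 0 <= l2norm a.
Proof. exact: sqrtr_ge0. Qed.

Lemma l2norm_eq0 (R : realType) (m : nat) (a : 'cV[R]_m) :
  (l2norm a == 0) = (a == 0).
Proof.
rewrite -(sqrf_eq0 (l2norm a)) sqr_l2norm psumr_eq0; last first.
  by move=> j _; exact: sqr_ge0.
apply/allP/eqP => [a0|-> j _]; last by rewrite mxE expr0n/= eqxx.
apply/colP => j; rewrite mxE; apply/eqP.
by have := a0 j (mem_index_enum j); rewrite /= sqrf_eq0.
Qed.

Lemma l2normZ (R : realType) (m : nat) (k : R) (a : 'cV[R]_m) :
  l2norm (k *: a) = `|k| * l2norm a.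
Proof.
rewrite /l2norm -sqrtr_sqr -sqrtrM ?sqr_ge0// mulr_sumr.
by congr (Num.sqrt _); apply: eq_bigr => j _; rewrite mxE exprMn.
Qed.

(** Cauchy-Schwarz: the squared norm of [C *: a - A *: c] expands to [2 * A * C * (A * C - S)], and
    [A * C] can be cancelled once zero norms are set apart. *)
Lemma l2norm_dot_le (R : realType) (m : nat) (a c : 'cV[R]_m) :
  \sum_(j < m) a j 0 * c j 0 <= l2norm a * l2norm c.
Proof.
set A := l2norm a; set C := l2norm c; set S := \sum_(j < m) _.
have [/eqP|A0] := eqVneq A 0.
  rewrite /A l2norm_eq0 => /eqP a0.
  rewrite /S big1 ?mulr_ge0 ?l2norm_ge0// => j _.
  by rewrite a0 mxE mul0r.
have [/eqP|C0] := eqVneq C 0.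
  rewrite /C l2norm_eq0 => /eqP c0.
  rewrite /S big1 ?mulr_ge0 ?l2norm_ge0// => j _.
  by rewrite c0 mxE mulr0.
have AC0 : 0 < A * C by rewrite mulr_gt0// lt_def ?A0 ?C0 l2norm_ge0.
have : 0 <= \sum_(j < m) (C * a j 0 - A * c j 0) ^+ 2.
  by rewrite sumr_ge0// => j _; exact: sqr_ge0.
have -> : \sum_(j < m) (C * a j 0 - A * c j 0) ^+ 2
    = C ^+ 2 * A ^+ 2 + A ^+ 2 * C ^+ 2 - (A * C) *+ 2 * S.
  rewrite [X in _ = _ * X + _ - _]sqr_l2norm.
  rewrite [X in _ = _ * _ + _ * X - _]sqr_l2norm.
  rewrite [in RHS]/S !mulr_sumr -big_split/= -sumrB; apply: eq_bigr => j _.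
  ring.
nra.
Qed.

(** The two sides differ only in their cross terms, which Cauchy-Schwarz compares. *)
Lemma sqr_l2normB_ge (R : realType) (m : nat) (a c : 'cV[R]_m) :
  (l2norm a - l2norm c) ^+ 2 <= l2norm (a - c) ^+ 2.
Proof.
have -> : l2norm (a - c) ^+ 2
    = l2norm a ^+ 2 + l2norm c ^+ 2 - (\sum_(j < m) a j 0 * c j 0) *+ 2.
  rewrite !sqr_l2norm -sumrMnl -big_split/= -sumrB; apply: eq_bigr => j _.
  by rewrite !mxE; ring.
by have := l2norm_dot_le a c; rewrite mulr2n; nra.
Qed.

(** Since [Theta] lies between 0 and its argument, [a] splits into two nonnegative multiples of
    itself. This is the equality case of the reverse triangle inequality. *)
Lemma vec_threshold_norms (R : realType) (Theta : R -> R -> R) (lambda : R)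
    (m : nat) (a : 'cV[R]_m) :
  threshold_function Theta -> 0 <= lambda ->
  l2norm (vec_threshold Theta lambda a) = Theta (l2norm a) lambda /\
  l2norm (a - vec_threshold Theta lambda a)
  = l2norm a - Theta (l2norm a) lambda.
Proof.
move=> HT l0; have [_ _ _ Tle] := HT _ l0.
have /andP[T0 T1] := Tle _ (l2norm_ge0 a).
rewrite /vec_threshold; case: ifP => [/eqP a0|/negbT].
  have n0 : l2norm a = 0 by apply/eqP; rewrite l2norm_eq0 a0.
  rewrite n0 in T0 T1 *.
  have -> : Theta 0 lambda = 0 by apply/eqP; rewrite eq_le T1 T0.
  by rewrite a0 !subr0 -[X in l2norm X]a0 n0.
rewrite -l2norm_eq0 => a0.
have na0 : 0 < l2norm a by rewrite lt_def a0 l2norm_ge0.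
split; first by rewrite l2normZ ger0_norm ?divfK// divr_ge0// l2norm_ge0.
set k := _ / _.
have -> : a - k *: a = (1 - k) *: a by rewrite scalerBl scale1r.
rewrite l2normZ ger0_norm ?mulrBl ?mul1r ?divfK//.
by rewrite subr_ge0 ler_pdivrMr// mul1r.
Qed.

Lemma residualE (R : realType) (n p m : nat) (X : 'M[R]_(n, p))
    (Y : 'M[R]_(n, m)) (B : 'M[R]_(p, m)) (i : 'I_n) :
  residual X Y B i = l2norm (vec_of_row (Y - X *m B) i).
Proof.
by rewrite /residual /vec_of_row -trmx_mul -linearB/= -row_mul -linearB.
Qed.

Lemma ls_objective_rows (R : realType) (n p m : nat) (X : 'M[R]_(n, p))
    (Y : 'M[R]_(n, m)) (B : 'M[R]_(p, m)) (C : 'M[R]_(n, m)) :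
  ls_objective X Y B C
  = \sum_(i < n)
      2^-1 * l2norm (vec_of_row (Y - X *m B) i - vec_of_row C i) ^+ 2.
Proof.
rewrite /ls_objective sqr_sqrtr; last first.
  by apply: sumr_ge0 => i _; apply: sumr_ge0 => j _; exact: sqr_ge0.
rewrite mulr_sumr; apply: eq_bigr => i _; rewrite sqr_l2norm.
by congr (_ * _); apply: eq_bigr => j _; rewrite !mxE.
Qed.

(** * Profiling by tight bounds, and sums of the smallest terms *)

(** Criterion used for both problems: for each [b], a lower bound [g b + k] on the inner problem
    that some feasible [c] attains. As [k] is the same for all [b], it does not affect the
    comparison of different [b]. *)
Lemma equivalent_by_profilingI (R : realType) (T U : Type) (D : set T)
    (E : set U) (f : T -> U -> R) (g : T -> R) (k : R) :
  (forall b, exists c, [/\ E c, f b c = g b + k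
     & forall c', E c' -> g b + k <= f b c']) ->
  equivalent_by_profiling D E f g.
Proof.
move=> H; split.
- move=> b; have [c [Ec fc minc]] := H b; exists c; split=> // c' Ec'.
  by rewrite fc; exact: minc.
- exists k => b; have [c [Ec fc minc]] := H b.
  apply/eqP; rewrite eq_le; apply/andP; split.
    rewrite -fc; apply: ge_inf; last by exists c.
    by exists (g b + k) => _ [c' Ec' <-]; exact: minc.
  apply: lb_le_inf; first by exists (f b c), c.
  by move=> _ [c' Ec' <-]; exact: minc.
(* All inner minimizers share the value [g b + k], so comparing optimal pairs amounts to comparing
   values of [g]. *)
- have minE b c : minimizer E (f b) c -> f b c = g b + k.
    move=> [Ec Hc]; have [c' [Ec' fc' minc']] := H b.
    by apply/eqP; rewrite eq_le minc'// -fc' Hc.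
  move=> b c; split=> [[[/= Db Ec] Hbc]|[[Db Hb] Hc]].
    have Hc : minimizer E (f b) c by split=> // c' Ec'; exact: (Hbc (b, c')).
    split=> //; split=> // b' Db'; have [c' [Ec' fc' _]] := H b'.
    by rewrite -(lerD2r k) -(minE _ _ Hc) -fc'; exact: (Hbc (b', c')).
  split=> [|[b' c'] [/= Db' Ec']]; first by split=> //; exact: Hc.1.
  have [_ [_ _ minc']] := H b'; apply: le_trans (minc' _ Ec').
  by rewrite (minE _ _ Hc) lerD2r; exact: Hb.
Qed.

(* With [tau] the largest value of [w] on [s1], [w - tau] is nonpositive on [s1]
   and nonnegative elsewhere. *)
Lemma sum_smallest_le (R : realDomainType) (I : finType) (w : I -> R)
    (s1 s2 : seq I) (A : {set I}) :
  (forall i, 0 <= w i) -> perm_eq (s1 ++ s2) (enum I) ->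
  {in s1 & s2, forall i j, w i <= w j} -> (size s1 <= #|A|)%N ->
  \sum_(i <- s1) w i <= \sum_(i in A) w i.
Proof.
move=> w0 perm12 w12 szA.
(* The base value 0 keeps [tau] nonnegative even for empty [s1], so that [tau *+ size s1] can be
   compared with [tau *+ #|A|] at the end. *)
pose tau := \big[Num.max/0]_(i <- s1) w i.
have tau0 : 0 <= tau by exact: bigmax_ge_id.
have us1 : uniq s1.
  by have := enum_uniq I; rewrite -(perm_uniq perm12) cat_uniq => /and3P[].
have w1 i : i \in s1 -> w i <= tau by move=> i1; exact: le_bigmax_seq.
have w2 i : i \notin s1 -> tau <= w i.
  move=> i1; have : i \in s1 ++ s2 by rewrite (perm_mem perm12) mem_enum.
  rewrite mem_cat (negbTE i1)/= => i2.
  rewrite /tau big_seq; apply: bigmax_le => // j j1; exact: w12.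
rewrite big_uniq//=.
have : \sum_(i in s1) (w i - tau) <= \sum_(i in A) (w i - tau).
  rewrite big_mkcond [leRHS]big_mkcond; apply: ler_sum => i _.
  case: ifPn => [/w1|/w2] wi; case: ifPn => // _.
    by rewrite subr_le0.
  by rewrite subr_ge0.
rewrite !sumrB !sumr_const (card_uniqP us1).
have : tau *+ size s1 <= tau *+ #|A| by exact: ler_wpMn2l.
lra.
Qed.

(** Sorting the values of [r] is sorting the indices by [|r i|] and then applying [r]. Cutting the
    list of indices after [k] entries settles ties. *)
Lemma order_stats_split (R : realType) (n k : nat) (r : 'I_n -> R) :
  (k <= n)%N -> exists s1 s2 : seq 'I_n,
  [/\ perm_eq (s1 ++ s2) (enum 'I_n), size s1 = k,
      {in s1 & s2, forall i j, r i ^+ 2 <= r j ^+ 2}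
    & \sum_(0 <= i < k) (nth 0 (order_stats r) i) ^+ 2
      = \sum_(i <- s1) r i ^+ 2].
Proof.
move=> kn; pose leT := fun a b : R => `|a| <= `|b|.
pose s := sort (relpre r leT) (enum 'I_n).
have szs : size s = n by rewrite size_sort size_enum_ord.
have leTtr : transitive (relpre r leT) by move=> y x z; exact: le_trans.
exists (take k s), (drop k s); split.
- by rewrite cat_take_drop perm_sort.
- by rewrite size_takel// szs.
- have : sorted (relpre r leT) s.
    by apply: sort_sorted => x y; exact: le_total.
  rewrite sorted_pairwise// -{1}(cat_take_drop k s) pairwise_cat.
  move=> /and3P[/allrelP rs _ _] i j i1 j2.
  have := rs _ _ i1 j2; rewrite /= /leT => rij.
  rewrite -(real_normK (num_real (r i))) -(real_normK (num_real (r j))).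
  by rewrite lerXn2r ?nnegrE.
- rewrite /order_stats sort_map -/leT -/s.
  have [->|k0] := posnP k; first by rewrite take0 !big_nil.
  (* A default index for [nth], available because [0 < k <= n]. *)
  have i0 : 'I_n by exact: (Ordinal (leq_trans k0 kn)).
  rewrite (big_nth i0) size_takel ?szs//.
  apply: eq_big_nat => i /andP[_ ik].
  by rewrite nth_take// (nth_map i0)// szs (leq_trans ik).
Qed.

(** * Lower bounds and attainment for the two problems *)

(** Row by row: the reverse triangle inequality, the scalar bound, and [q >= 0]. Each row leaves one
    [P 0 lambda], whence the constant. *)
Lemma penalized_objective_ge (R : realType) (n p m : nat) (X : 'M[R]_(n, p))
    (Y : 'M[R]_(n, m)) (Theta P : R -> R -> R) (lambda : R)
    (B : 'M[R]_(p, m)) (C : 'M[R]_(n, m)) :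
  threshold_function Theta -> 0 <= lambda ->
  associated_penalty Theta P lambda ->
  robust_objective Theta lambda X Y B + P 0 lambda *+ n
  <= penalized_objective P lambda X Y B C.
Proof.
move=> HT l0 [q [q0 qT PE]].
rewrite /penalized_objective /robust_objective ls_objective_rows -big_split/=.
rewrite -[X in _ + _ *+ X <= _]card_ord -sumr_const -big_split/=.
apply: ler_sum => i _; rewrite residualE.
set a := vec_of_row _ _; set c := vec_of_row _ _.
have [H _] := rho_le_penalized HT l0 (l2norm_ge0 a).
have := H _ (l2norm_ge0 c); have := sqr_l2normB_ge a c.
have := PE (l2norm c); have := q0 (l2norm c); lra.
Qed.

(** The three inequalities of the lower bound become equalities; in particular [q] vanishes on the
    values of [Theta]. *)
Lemma penalized_objective_threshold (R : realType) (n p m : nat)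
    (X : 'M[R]_(n, p)) (Y : 'M[R]_(n, m)) (Theta P : R -> R -> R)
    (lambda : R) (B : 'M[R]_(p, m)) :
  threshold_function Theta -> 0 <= lambda ->
  associated_penalty Theta P lambda ->
  penalized_objective P lambda X Y B (mx_threshold Theta lambda (Y - X *m B))
  = robust_objective Theta lambda X Y B + P 0 lambda *+ n.
Proof.
move=> HT l0 [q [q0 qT PE]].
rewrite /penalized_objective /robust_objective ls_objective_rows -big_split/=.
rewrite -[X in _ = _ + _ *+ X]card_ord -sumr_const -big_split/=.
apply: eq_bigr => i _; rewrite residualE.
set a := vec_of_row _ _.
have -> : vec_of_row (mx_threshold Theta lambda (Y - X *m B)) i
    = vec_threshold Theta lambda a by apply/colP => j; rewrite !mxE.
have [-> ->] := vec_threshold_norms a HT l0.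
have [_ ->] := rho_le_penalized HT l0 (l2norm_ge0 a).
have := PE (Theta (l2norm a) lambda); rewrite qT; lra.
Qed.

(** At least [n - k] rows of [C] vanish, and each of these contributes its full squared residual; no
    such family sums to less than the [n - k] smallest. *)
Lemma ls_objective_trimmed_ge (R : realType) (n p m : nat)
    (X : 'M[R]_(n, p)) (Y : 'M[R]_(n, m)) (k : nat) (B : 'M[R]_(p, m))
    (C : 'M[R]_(n, m)) :
  (norm20 C <= k)%N -> trimmed_objective X Y k B <= ls_objective X Y B C.
Proof.
move=> Ck.
have [s1 [s2 [perm12 sz1 r12 sumE]]] :=
  order_stats_split (residual X Y B) (leq_subr k n).
rewrite /trimmed_objective sumE ls_objective_rows -mulr_sumr.
rewrite ler_pM2l ?invr_gt0//.
pose A := [set i | row i C == 0]%SET.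
have szA : (size s1 <= #|A|)%N.
  rewrite sz1 leq_subLR -[X in (X <= _)%N]card_ord.
  rewrite -(cardC [pred i | row i C != 0]).
  apply: leq_add => //; apply: subset_leq_card.
  by apply/fintype.subsetP => i; rewrite !inE negbK.
apply: le_trans (sum_smallest_le _ perm12 r12 szA) _ => [i|].
  exact: sqr_ge0.
rewrite big_mkcond; apply: ler_sum => i _; case: ifPn => [|_]; last first.
  exact: sqr_ge0.
rewrite inE residualE [vec_of_row C i]/vec_of_row => /eqP ->.
by rewrite trmx0 subr0.
Qed.

Lemma ls_objective_trimmed_attained (R : realType) (n p m : nat)
    (X : 'M[R]_(n, p)) (Y : 'M[R]_(n, m)) (k : nat) (B : 'M[R]_(p, m)) :
  (k <= n)%N -> exists C : 'M[R]_(n, m),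
  (norm20 C <= k)%N /\ ls_objective X Y B C = trimmed_objective X Y k B.
Proof.
move=> kn.
have [s1 [s2 [perm12 sz1 r12 sumE]]] :=
  order_stats_split (residual X Y B) (leq_subr k n).
(* The rows in [s2], those with the [k] largest residuals, are fitted exactly. Some may be zero
   already, so [norm20] can fall below [k]. *)
exists (\matrix_(i, j) if i \in s1 then 0 else (Y - X *m B) i j); split.
  have sz2 : size s2 = k.
    apply: (@addnI (n - k)%N); rewrite subnK// -sz1 -size_cat.
    by rewrite (perm_size perm12) size_enum_ord.
  rewrite -sz2 /norm20; apply: leq_trans (card_size s2).
  apply: subset_leq_card; apply/fintype.subsetP => i; rewrite inE => Ci.
  have : i \in s1 ++ s2 by rewrite (perm_mem perm12) mem_enum.
  rewrite mem_cat => /orP[i1|//]; case/eqP: Ci.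
  by apply/rowP => j; rewrite !mxE i1.
have us1 : uniq s1.
  have := enum_uniq 'I_n.
  by rewrite -(perm_uniq perm12) cat_uniq => /and3P[].
rewrite /trimmed_objective sumE ls_objective_rows -mulr_sumr (big_uniq _ us1).
congr (_ * _); rewrite [RHS]big_mkcond; apply: eq_bigr => i _.
rewrite residualE !sqr_l2norm; case: ifPn => i1; last first.
  by apply: big1 => j _; rewrite !mxE (negbTE i1) subrr expr0n.
by apply: eq_bigr => j _; rewrite !mxE i1 subr0.
Qed.

Theorem theorem2 (R : realType) (n p m : nat) (X : 'M[R]_(n, p))
    (Y : 'M[R]_(n, m)) (r : nat) :
  (forall (Theta P : R -> R -> R) (lambda : R),
     threshold_function Theta -> 0 <= lambda ->
     associated_penalty Theta P lambda ->
     (forall B : 'M[R]_(p, m),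
        minimizer [set: 'M[R]_(n, m)] (penalized_objective P lambda X Y B)
          (mx_threshold Theta lambda (Y - X *m B))) /\
     equivalent_by_profiling
       [set B : 'M[R]_(p, m) | (\rank B <= r)%N] [set: 'M[R]_(n, m)]
       (penalized_objective P lambda X Y)
       (robust_objective Theta lambda X Y))
  /\
  (forall varrho : nat, (varrho <= n)%N ->
     equivalent_by_profiling
       [set B : 'M[R]_(p, m) | (\rank B <= r)%N]
       [set C : 'M[R]_(n, m) | (norm20 C <= varrho)%N]
       (ls_objective X Y)
       (trimmed_objective X Y varrho)).
Proof.
split=> [ Theta P lambda HT l0 HP|k kn].
  split=> [B|].
    split=> [//|C _]; rewrite penalized_objective_threshold//.
    exact: penalized_objective_ge.
  apply: (equivalent_by_profilingI _ (k := P 0 lambda *+ n)) => B.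
  exists (mx_threshold Theta lambda (Y - X *m B)); split=> // [|C _].
    exact: penalized_objective_threshold.
  exact: penalized_objective_ge.
apply: (equivalent_by_profilingI _ (k := 0)) => B.
have [C [Ck CE]] := ls_objective_trimmed_attained X Y B kn.
exists C; split; rewrite ?addr0// => C' ?.
exact: ls_objective_trimmed_ge.
Qed.
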